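(* For every $n\ge2$ and positive weights $a,b,c$, the dimer partition function of the Sierpiński graph $\Gamma_n$ with the ''rotation-invariant'' labeling is: - for $n$ even, $$\Phi_n(a,b,c)=2^{\frac{3^{n-2}-1}{2}}(a^3+b^3)^{\frac{3^{n-2}-1}{4}}(ac+bc)^{\frac{3^{n-1}-3}{4}}\big(a^3+b^3+3c(a+b)\big);$$ - for $n$ odd, $$\Phi_n(a,b,c)=2^{\frac{3^{n-2}-1}{2}}(a^3+b^3)^{\frac{3^{n-2}-3}{4}}(ac+bc)^{\frac{3^{n-1}-1}{4}}\big(3(a^3+b^3)+c(a+b)\big).$$
   Context: The labeled graphs $\Gamma_n$ ($n\ge2$) each have three distinguished corners, called $L$, $U$, $R$. $\Gamma_2$ has vertices $L,U,R,X,Y,Z$ and nine edges: - $L$–$X$, $U$–$Y$, $R$–$Z$, labeled $a$; - $L$–$Z$, $U$–$X$, $R$–$Y$, labeled $b$; - $X$–$Y$, $Y$–$Z$, $Z$–$X$, labeled $c$. For $n\ge3$, $\Gamma_n$ is obtained from three copies $\Gamma^{L},\Gamma^{U},\Gamma^{R}$ of the labeled graph $\Gamma_{n-1}$ by identifying: - the corner $R$ of $\Gamma^L$ with the corner $L$ of $\Gamma^R$; - the corner $U$ of $\Gamma^L$ with the corner $L$ of $\Gamma^U$; - the corner $R$ of $\Gamma^U$ with the corner $U$ of $\Gamma^R$. The corners of $\Gamma_n$ are the $L$-corner of $\Gamma^L$, the $U$-corner of $\Gamma^U$, and the $R$-corner of $\Gamma^R$. This gives the level-$n$ Sierpiński gasket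 graph with a labeling invariant under rotation by $2\pi/3$. A dimer covering of $\Gamma_n$ is a matching covering every non-corner vertex, and - for $n$ odd, covering exactly $0$ or $2$ corners; - for $n$ even, covering exactly $1$ or $3$ corners. With an edge labeled $s$ having weight $s>0$, $\Phi_n(a,b,c)$ is the sum over dimer coverings of the product of the weights. *)

(* Defs.v *)
From HB Require Import structures.
From mathcomp Require Import all_boot all_order all_algebra.

Set Implicit Arguments.
Unset Strict Implicit.
Unset Printing Implicit Defensive.

Import GRing.Theory.
Local Open Scope quotient_scope.

Inductive label := La | Lb | Lc.

(* Indexes both the three corners of a graph and the three copies that are
   glued together in the recursive step. *)
Inductive corner := CL | CU | CR.

Definition corner_code (x : corner) : 'I_3 :=
  match x with
  | CL => @Ordinal 3 0 isT
  | CU => @Ordinal 3 1 isT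
  | CR => @Ordinal 3 2 isT
  end.
Definition corner_decode (i : 'I_3) : corner := nth CL [:: CL; CU; CR] i.
Lemma corner_codeK : cancel corner_code corner_decode.
Proof. by case. Qed.
HB.instance Definition _ := Countable.copy corner (can_type corner_codeK).
HB.instance Definition _ : isFinite corner := CanIsFinite corner_codeK.

(* Edges are unoriented: only the set of the two components of [ends e]
   matters in what follows. *)
Record lgraph := LGraph {
  vertex : finType;
  edge : finType;
  ends : edge -> vertex * vertex;
  elabel : edge -> label;
  corner_of : corner -> vertex
}.

(* The vertices of the level-2 graph are the corners L, U, R, represented by
   [inl], and the three other vertices X, Y, Z, represented by [inr] of
   0, 1 and 2. *)
Definition vertex2 : finType := (corner + 'I_3)%type.

Definition edges2 : 9.-tuple (vertex2 * vertex2 * label) :=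
  let L : vertex2 := inl CL in
  let U : vertex2 := inl CU in
  let R : vertex2 := inl CR in
  let X : vertex2 := inr (@Ordinal 3 0 isT) in
  let Y : vertex2 := inr (@Ordinal 3 1 isT) in
  let Z : vertex2 := inr (@Ordinal 3 2 isT) in
  [tuple (L, X, La); (U, Y, La); (R, Z, La);
         (L, Z, Lb); (U, X, Lb); (R, Y, Lb);
         (X, Y, Lc); (Y, Z, Lc); (Z, X, Lc)].

Definition Gamma2 : lgraph :=
  @LGraph vertex2 'I_9
    (fun i => (tnth edges2 i).1) (fun i => (tnth edges2 i).2) inl.

Section Glue.
Variable G : lgraph.

(* [(k, v)] is the vertex [v] of the copy of [G] indexed by [k]. *)
Definition copies : finType := (corner * vertex G)%type.

Definition identified : seq (copies * copies) :=
  [:: ((CL, corner_of G CR), (CR, corner_of G CL));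
      ((CL, corner_of G CU), (CU, corner_of G CL));
      ((CU, corner_of G CR), (CR, corner_of G CU))].

Definition glue_step : rel copies :=
  fun x y => ((x, y) \in identified) || ((y, x) \in identified).

(* [connect glue_step] is the equivalence relation generated by the three
   identifications. *)
Lemma glue_sym : symmetric (connect glue_step).
Proof. by apply: sym_connect_sym => x y; rewrite /glue_step orbC. Qed.

Definition glue_equiv : equiv_rel copies :=
  EquivRel (connect glue_step)
    (connect0 glue_step) glue_sym (@connect_trans _ glue_step).

Definition glue_quot : finType := quot_type {eq_quot glue_equiv}.

Definition glue_class (x : copies) : glue_quot := \pi_({eq_quot glue_equiv}) x.

Definition glue : lgraph :=
  @LGraph glue_quot (corner * edge G)%type
    (fun e => (glue_class (e.1, (ends e.2).1), glue_class (e.1, (ends e.2).2)))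
    (fun e => elabel e.2)
    (fun k => glue_class (k, corner_of G k)).

End Glue.

(* Meaningful for [2 <= n] only. *)
Definition Gamma (n : nat) : lgraph := iter (n - 2) glue Gamma2.

Section Dimers.
Variable G : lgraph.

Definition incident (e : edge G) (v : vertex G) : bool :=
  (v == (ends e).1) || (v == (ends e).2).

Definition matching (M : {set edge G}) : bool :=
  [forall e in M, forall f in M, (e != f) ==>
    [forall v, ~~ (incident e v && incident f v)]].

Definition covers (M : {set edge G}) (v : vertex G) : bool :=
  [exists e in M, incident e v].

Definition corners : {set vertex G} := [set corner_of G k | k : corner].

Definition ncovered_corners (M : {set edge G}) : nat :=
  #|[set v in corners | covers M v]|.

(* [odd_level] is the parity of the level of the graph [G]. *)
Definition dimer_covering (odd_level : bool) (M : {set edge G}) : bool :=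
  [&& matching M,
      [forall v, (v \notin corners) ==> covers M v]
    & ncovered_corners M \in (if odd_level then [:: 0; 2] else [:: 1; 3])].

End Dimers.

Local Open Scope ring_scope.

Definition weight (R : Type) (a b c : R) (l : label) : R :=
  match l with La => a | Lb => b | Lc => c end.

Definition Phi (R : realFieldType) (n : nat) (a b c : R) : R :=
  \sum_(M : {set edge (Gamma n)} | dimer_covering (odd n) M)
    \prod_(e in M) weight a b c (elabel e).

(* Main.v *)
(* The three identifications, together with the corners of the new graph, have
   the uniform description (k, corner j) ~ (j, corner k). Hence, if Z_S is the
   weight of the edge sets covering every non-corner vertex once and exactly the
   corners in S, then Z_S at level n+1 is a sum over the 8 choices, for each of
   the three junctions, of the copy that covers it, of products of three values
   of Z at level n. Put P = a^3 + b^3 and Q = c(a+b). The sizes of the sets S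
   with Z_S nonzero have fixed parity, and Z_S is C_n times P or Q, according to
   |S| >= 2 or |S| <= 1, with C_2 = 1 and C_(n+1) = 2 C_n^3 Q^2 for n even,
   C_(n+1) = 2 C_n^3 P^2 for n odd. *)
Require Import Defs.
From mathcomp Require Import all_boot all_order all_algebra.
From mathcomp Require Import ring zify.

Set Implicit Arguments.
Unset Strict Implicit.
Unset Printing Implicit Defensive.

Import GRing.Theory.
Local Open Scope ring_scope.

(** * Expansion over the three corners *)

Lemma big_corner (T : Type) (idx : T) (op : Monoid.com_law idx)
    (F : corner -> T) :
  \big[op/idx]_(k : corner) F k = op (F CL) (op (F CU) (F CR)).
Proof.
rewrite (reindex corner_decode) /=; last first.
  exists corner_code => [i _|k _]; last exact: corner_codeK.
  by apply: val_inj; case: i => [[|[|[|]]]].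
by rewrite 2!big_ord_recl big_ord1.
Qed.

Lemma forall_corner (P : pred corner) :
  [forall k, P k] = [&& P CL, P CU & P CR].
Proof. by apply/forallP/and3P => [P_|[PL PU PR] []]; first split. Qed.

Definition pattern (l u r : bool) (k : corner) : bool :=
  match k with CL => l | CU => u | CR => r end.

(** * Edge sets covering a prescribed set of corners *)

Section ExactCovers.
Variable G : lgraph.
Implicit Types (M : {set edge G}) (p : corner -> bool).

Definition degree M (v : vertex G) : nat := #|[set e in M | incident e v]|.

(** Matching and covering are merged into conditions on degrees, because degrees add up when copies
    are glued. *)
Definition exact_cover p M : bool :=
  [forall v, (v \notin corners G) ==> (degree M v == 1%N)]
  && [forall k, degree M (corner_of G k) == p k].

Lemma degreeE M v : degree M v = (\sum_(e in M) incident e v)%N.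
Proof.
rewrite /degree -sum1_card big_mkcond [RHS]big_mkcond.
by apply: eq_bigr => e _; rewrite inE; case: (e \in M); case: incident.
Qed.

Lemma coversE M v : covers M v = (0 < degree M v)%N.
Proof.
rewrite /degree card_gt0; apply/exists_inP/set0Pn => -[e].
  by move=> eM ev; exists e; rewrite inE eM.
by rewrite inE => /andP[eM ev]; exists e.
Qed.

Lemma matchingP M : reflect (forall v, degree M v <= 1)%N (matching M).
Proof.
apply: (iffP idP) => [mM v|deg1].
  apply/card_le1_eqP => e f; rewrite !inE => /andP[eM ev] /andP[fM fv].
  apply/eqP/negPn/negP => ef.
  move/forall_inP/(_ e eM)/forall_inP/(_ f fM): mM.
  by rewrite eq_sym ef => /forallP/(_ v); rewrite ev fv.
apply/forall_inP => e eM; apply/forall_inP => f fM; apply/implyP => ef.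
apply/forallP => v; apply/negP => /andP[ev fv].
have /card_le1_eqP/(_ e f) := deg1 v.
by rewrite !inE eM ev fM fv => /(_ isT isT) /eqP; rewrite eq_sym (negPf ef).
Qed.

Lemma exact_coverP p M :
  reflect [/\ matching M, forall v, v \notin corners G -> covers M v
            & forall k, covers M (corner_of G k) = p k]
          (exact_cover p M).
Proof.
apply: (iffP andP) => [[/forall_inP nc /forallP co]|[mM nc co]].
  split=> [|v /nc/eqP|k]; rewrite ?coversE; last 2 first.
  - by move->.
  - by rewrite (eqP (co k)); case: (p k).
  apply/matchingP => v; have [/imsetP[k _ ->]|/nc/eqP->//] := boolP (v \in corners G).
  by rewrite (eqP (co k)) leq_b1.
have deg v : degree M v = covers M v.
  by rewrite coversE; have /matchingP/(_ v) := mM; case: (degree M v) => [|[]].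
split; first by apply/forall_inP => v /nc; rewrite deg => ->.
by apply/forallP => k; rewrite deg co.
Qed.

Lemma ncovered_cornersE M : injective (corner_of G) ->
  ncovered_corners M = (\sum_k covers M (corner_of G k))%N.
Proof.
move=> inj; rewrite /ncovered_corners.
have -> : [set v in corners G | covers M v] =
    corner_of G @: [set k | covers M (corner_of G k)].
  apply/setP => v; rewrite inE; apply/andP/imsetP.
    by case=> /imsetP[k _ ->] ck; exists k; rewrite ?inE.
  by case=> k; rewrite inE => ck ->; split; first exact: imset_f.
rewrite card_imset // -sum1_card big_mkcond.
by apply: eq_bigr => k _; rewrite inE; case: covers.
Qed.

Variables (R : comNzRingType) (w : label -> R).

Definition set_weight M : R := \prod_(e in M) w (elabel e).

Definition cover_sum p : R := \sum_(M | exact_cover p M) set_weight M.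

(** Dimer coverings are sorted by the triple of bits telling which corners they cover. Injectivity
    of [corner_of] makes the number of covered corners the sum of these bits. *)
Lemma dimer_sumE odd_level : injective (corner_of G) ->
  \sum_(M | dimer_covering odd_level M) set_weight M =
  \sum_(t : bool * bool * bool |
        (t.1.1 + t.1.2 + t.2)%N \in (if odd_level then [:: 0; 2] else [:: 1; 3])%N)
    cover_sum (pattern t.1.1 t.1.2 t.2).
Proof.
move=> inj; set S := (if _ then _ else _).
have nE M : ncovered_corners M =
    (covers M (corner_of G CL) + covers M (corner_of G CU)
     + covers M (corner_of G CR))%N.
  by rewrite ncovered_cornersE // big_corner /= addnA.
rewrite (partition_big (fun M => (covers M (corner_of G CL),
  covers M (corner_of G CU), covers M (corner_of G CR)))
  (fun t => (t.1.1 + t.1.2 + t.2)%N \in S)) /=; last first.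
  by move=> M /and3P[_ _]; rewrite nE.
apply: eq_bigr => -[[l u] r] /= tS; apply: eq_bigl => M.
apply/andP/exact_coverP => [[/and3P[mM /forall_inP nc _] /eqP[cl cu cr]]|].
  by split=> //; case.
case=> mM nc co; rewrite !co eqxx; split=> //; apply/and3P; split=> //.
  by apply/forall_inP.
by rewrite nE !co.
Qed.

End ExactCovers.

(** * Gluing three copies: the recursion for [cover_sum] *)

Section Gluing.
Variable G : lgraph.
Hypothesis inj : injective (corner_of G).

Lemma glue_stepP (x y : copies G) :
  reflect (exists k j, [/\ k != j, x = (k, corner_of G j) & y = (j, corner_of G k)])
          (glue_step x y).
Proof.
rewrite /glue_step /identified !inE; apply: (iffP idP).
  case/or4P=> [/or3P[]|||] /eqP[-> ->].
  - by exists CL, CR.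
  - by exists CL, CU.
  - by exists CU, CR.
  - by exists CR, CL.
  - by exists CU, CL.
  - by exists CR, CU.
by case=> k [j [kj -> ->]]; case: k j kj => [] [] // _; rewrite !eqxx ?orbT.
Qed.

(** [glue_step] is a partial involution exchanging (k, corner j) and (j, corner k), so its
    equivalence closure only adds the diagonal. *)
Lemma glue_class_eq (x y : copies G) :
  (glue_class x == glue_class y) = (x == y) || glue_step x y.
Proof.
have -> : (glue_class x == glue_class y) = connect (@glue_step G) x y.
  by apply/eqP/idP => [/eqmodP|xy] //; apply/eqmodP.
apply/idP/idP; last first.
  by case/orP=> [/eqP->|/connect1].
case/connectP=> s; elim: s x => [|z s IHs] x /= => [_ ->|/andP[xz zs] yE].
  by rewrite eqxx.
have /orP[/eqP<-|zy] := IHs z zs yE; first by rewrite xz orbT.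
(* Two consecutive steps lead back to the start: here y is x. *)
have /glue_stepP[k [j [_ -> zE]]] := xz.
have /glue_stepP[k' [j' [_ zE' ->]]] := zy.
by move: zE'; rewrite zE => -[-> /inj->]; rewrite eqxx.
Qed.

Lemma corner_of_glue_inj : injective (corner_of (glue G)).
Proof.
move=> k j /eqP; rewrite glue_class_eq => /orP[/eqP[]//|].
by case/glue_stepP=> k' [j' [kj [-> /inj->] [-> _]]].
Qed.

Definition slice (M : {set edge (glue G)}) (k : corner) : {set edge G} :=
  [set e | (k, e) \in M].

Lemma big_slice (T : Type) (idx : T) (op : Monoid.com_law idx)
    (M : {set edge (glue G)}) (F : edge (glue G) -> T) :
  \big[op/idx]_(e in M) F e = \big[op/idx]_k \big[op/idx]_(e in slice M k) F (k, e).
Proof.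
rewrite pair_big_dep /=.
by apply: eq_big => [[k e]|[k e] _] //=; rewrite inE.
Qed.

Lemma incident_glue_same k (e : edge G) v :
  @incident (glue G) (k, e) (glue_class (k, v)) = incident e v.
Proof.
have E u : (glue_class (k, v) == glue_class (k, u)) = (v == u).
  rewrite glue_class_eq xpair_eqE eqxx /=.
  case: glue_stepP => [[k1 [j1 [ne [k1E _] [j1E _]]]]|_]; last by rewrite orbF.
  by rewrite -k1E -j1E eqxx in ne.
by rewrite /incident /= !E.
Qed.

Lemma incident_glue_diff k j (e : edge G) v : j != k ->
  @incident (glue G) (j, e) (glue_class (k, v)) =
  (v == corner_of G j) && incident e (corner_of G k).
Proof.
move=> jk.
have E u : (glue_class (k, v) == glue_class (j, u)) =
    (v == corner_of G j) && (corner_of G k == u).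
  rewrite glue_class_eq xpair_eqE eq_sym (negPf jk) /=.
  apply/glue_stepP/andP => [[k1 [j1 [ne [-> ->] [-> ->]]]]|[/eqP-> /eqP<-]] //.
  by exists k, j; rewrite eq_sym.
by rewrite /incident /= !E; case: (v == _).
Qed.

(** An edge of another copy j reaches the vertex v of copy k only at the junction of the two copies,
    which is corner j of copy k and corner k of copy j. *)
Lemma degree_glue M k v :
  degree M (glue_class (k, v) : vertex (glue G)) =
  (degree (slice M k) v +
   \sum_(j | (j != k) && (v == corner_of G j)) degree (slice M j) (corner_of G k))%N.
Proof.
rewrite degreeE big_slice (bigD1 k) //= degreeE; congr (_ + _)%N.
  by apply: eq_bigr => e _; rewrite incident_glue_same.
rewrite big_mkcondr; apply: eq_bigr => j jk.
under eq_bigr => e _ do rewrite (incident_glue_diff _ _ jk).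
by case: eqP => /= _; rewrite ?degreeE ?big1_eq.
Qed.

Lemma degree_glue_inner M k v : v \notin corners G ->
  degree M (glue_class (k, v) : vertex (glue G)) = degree (slice M k) v.
Proof.
move=> nc; rewrite degree_glue big1 ?addn0 // => j /andP[_ /eqP vE].
by rewrite vE imset_f in nc.
Qed.

Lemma degree_glue_corner M k :
  degree M (corner_of (glue G) k) = degree (slice M k) (corner_of G k).
Proof.
rewrite degree_glue big1 ?addn0 // => j /andP[jk /eqP/inj kj].
by rewrite kj eqxx in jk.
Qed.

Lemma degree_glue_junction M k j : j != k ->
  degree M (glue_class (k, corner_of G j) : vertex (glue G)) =
  (degree (slice M k) (corner_of G j) + degree (slice M j) (corner_of G k))%N.
Proof.
move=> jk; rewrite degree_glue (big_pred1 j) // => i /=.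
rewrite (inj_eq inj) eq_sym; case: (eqVneq i j) => [->|ij]; first by rewrite eq_sym jk.
by rewrite andbF.
Qed.

Lemma glue_class_corners k v :
  ((glue_class (k, v) : vertex (glue G)) \in corners (glue G)) = (v == corner_of G k).
Proof.
apply/imsetP/eqP => [[j _ /eqP]|->]; last by exists k.
rewrite glue_class_eq => /orP[/eqP[-> ->]//|].
by case/glue_stepP=> k1 [j1 [ne [-> ->] [-> ->]]].
Qed.

(** A non-corner vertex of the glued graph is either a non-corner vertex of one copy or a junction;
    only at a junction do two copies contribute to the degree. *)
Lemma exact_cover_glueP (p : corner -> bool) M :
  reflect
    [/\ forall k v, v \notin corners G -> degree (slice M k) v = 1%N,
        forall k j, j != k ->
          (degree (slice M k) (corner_of G j) + degree (slice M j) (corner_of G k))%N = 1%N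
      & forall k, degree (slice M k) (corner_of G k) = p k]
    (exact_cover (G := glue G) p M).
Proof.
apply: (iffP andP) => [[/forall_inP nc /forallP co]|[nc ju co]].
  split=> [k v vn|k j jk|k]; last by rewrite -degree_glue_corner (eqP (co k)).
    rewrite -degree_glue_inner //; apply/eqP/nc; rewrite glue_class_corners.
    by apply: contraNneq vn => ->; rewrite imset_f.
  rewrite -degree_glue_junction //; apply/eqP/nc.
  by rewrite glue_class_corners (inj_eq inj).
split; last by apply/forallP => k; rewrite degree_glue_corner co.
apply/forall_inP => q; have [[k v] ->] : exists x, q = glue_class x.
  by exists (generic_quotient.repr q); rewrite /glue_class generic_quotient.reprK.
rewrite glue_class_corners => vk.
have [/imsetP[j _ vE]|vn] := boolP (v \in corners G); last first.
  by rewrite degree_glue_inner ?nc.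
rewrite vE (inj_eq inj) in vk *.
by rewrite degree_glue_junction // ju.
Qed.

(* [t] tells whether the first copy is the one that covers the junction of the
   copies L-R, L-U and U-R, in this order. *)
Definition copy_pattern p (t : bool * bool * bool) (k : corner) : corner -> bool :=
  match k with
  | CL => pattern (p CL) t.1.2 t.1.1
  | CU => pattern (~~ t.1.2) (p CU) t.2
  | CR => pattern (~~ t.1.1) (~~ t.2) (p CR)
  end.

Lemma exact_cover_slices p t M :
  exact_cover (G := glue G) p M
    && ((degree (slice M CL) (corner_of G CR) == 1%N,
         degree (slice M CL) (corner_of G CU) == 1%N,
         degree (slice M CU) (corner_of G CR) == 1%N) == t)
  = [forall k, exact_cover (copy_pattern p t k) (slice M k)].
Proof.
case: t => [[x y] z]; apply/andP/forallP.
  case=> /exact_cover_glueP[nc ju co] /eqP[xE yE zE] k.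
  apply/andP; split; first by apply/forall_inP => v vn; rewrite nc.
  (* The two degrees at a junction sum to 1, so one bit determines both. *)
  have half m n : (m + n = 1 -> m = (m == 1) /\ n = ~~ (m == 1))%N.
    by case: m n => [|[|m]] [|[|n]].
  have [xL xR] := half _ _ (ju CL CR isT).
  have [yL yU] := half _ _ (ju CL CU isT).
  have [zU zR] := half _ _ (ju CU CR isT).
  rewrite forall_corner; case: k => /=;
    by apply/and3P; split; apply/eqP; rewrite ?co -?xE -?yE -?zE.
move=> ex.
have nc k v : v \notin corners G -> degree (slice M k) v = 1%N.
  by move=> vn; have /andP[/forall_inP/(_ v vn)/eqP] := ex k.
have co k j : degree (slice M k) (corner_of G j) = copy_pattern p (x, y, z) k j.
  by have /andP[_ /forallP/(_ j)/eqP] := ex k.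
split; last by rewrite !co /=; case: x y z {ex co} => [] [] [].
apply/exact_cover_glueP; split=> // [k j jk|k]; rewrite !co; last by case: k.
by case: k j jk => [] [] //= _; case: x y z {ex co} => [] [] [].
Qed.

Variables (R : comNzRingType) (w : label -> R).

(** Once the copy covering each junction is fixed, the three slices of an edge set vary
    independently, and the sum factors. *)
Lemma cover_sum_glue p :
  cover_sum (glue G) w p =
  \sum_(t : bool * bool * bool) \prod_k cover_sum G w (copy_pattern p t k).
Proof.
rewrite /cover_sum (partition_big (fun M : {set edge (glue G)} =>
  (degree (slice M CL) (corner_of G CR) == 1%N,
   degree (slice M CL) (corner_of G CU) == 1%N,
   degree (slice M CU) (corner_of G CR) == 1%N)) xpredT) //=.
apply: eq_bigr => t _.
under eq_bigl => M do rewrite exact_cover_slices.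
(* Inexact slices get value 0, so that the product of sums distributes over all triples of edge
   sets. *)
under [RHS]eq_bigr => k _ do rewrite big_mkcond.
rewrite bigA_distr_bigA /=.
pose join (f : {ffun corner -> {set edge G}}) : {set edge (glue G)} :=
  [set ke | ke.2 \in f ke.1].
have sliceK f k : slice (join f) k = f k by apply/setP => e; rewrite !inE.
rewrite (reindex join) /=; last first.
  exists (fun M => [ffun k => slice M k]) => [f _|M _].
    by apply/ffunP => k; rewrite ffunE sliceK.
  by apply/setP => -[k e]; rewrite inE ffunE inE.
rewrite big_mkcond; apply: eq_bigr => f _.
under eq_forallb => k do rewrite sliceK.
case: ifPn => [/forallP ex|/forallPn[k nex]]; last first.
  by rewrite (bigD1 k) //= (negPf nex) mul0r.
rewrite /set_weight big_slice; apply: eq_bigr => k _.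
by rewrite ex sliceK.
Qed.

End Gluing.

(** * The level-2 graph, by enumeration of its edge sets *)

Fixpoint bitseqs (n : nat) : seq bitseq :=
  if n is n'.+1 then map (cons true) (bitseqs n') ++ map (cons false) (bitseqs n')
  else [:: [::]].

Lemma mem_bitseqs n s : (s \in bitseqs n) = (size s == n).
Proof.
elim: n s => [|n IHn] [|b s] //=; rewrite mem_cat.
  by apply/norP; split; apply/mapP => -[].
apply/orP/eqP => [[/mapP|/mapP]|[/eqP]].
- by case=> s' + [_ ->]; rewrite IHn => /eqP->.
- by case=> s' + [_ ->]; rewrite IHn => /eqP->.
- by rewrite -IHn => sn; case: b; [left|right]; exact: map_f.
Qed.

Lemma bitseqs_uniq n : uniq (bitseqs n).
Proof.
elim: n => //= n IHn; rewrite cat_uniq !map_inj_uniq; try by move=> ? ? [].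
rewrite IHn andbT /=; apply/hasPn => _ /mapP[s _ ->].
by apply/mapP => -[].
Qed.

(** Replaces the enumeration of [{set 'I_n}] by a plain list on which the filter can be
    evaluated. *)
Lemma big_set_bitseqs (T : Type) (idx : T) (op : Monoid.com_law idx) n
    (F : {set 'I_n} -> T) :
  \big[op/idx]_(M : {set 'I_n}) F M =
  \big[op/idx]_(s <- bitseqs n) F [set i : 'I_n | nth false s i].
Proof.
rewrite (reindex (fun t : n.-tuple bool => [set i : 'I_n | nth false t i])).
  rewrite -(big_map val xpredT (fun s => F [set i : 'I_n | nth false s i])) /=.
  apply/perm_big/uniq_perm; rewrite ?bitseqs_uniq ?(map_inj_uniq val_inj) //.
    exact: index_enum_uniq.
  move=> s; rewrite mem_bitseqs; apply/mapP/eqP => [[t _ ->]|sn].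
    exact: size_tuple.
  by exists (tcast sn (in_tuple s)); rewrite ?mem_index_enum ?val_tcast.
exists (fun M : {set 'I_n} => [tuple (i \in M) | i < n]) => [t _|M _].
  by apply: eq_from_tnth => i; rewrite tnth_mktuple inE (tnth_nth false).
by apply/setP => i; rewrite inE -tnth_nth tnth_mktuple.
Qed.

Section Base.
Variables (R : comNzRingType) (a b c : R).

Definition edge2 (i : nat) : vertex2 * vertex2 * label :=
  nth (inl CL, inl CL, La) edges2 i.

(* The boolean criterion for the edge set coded by [s] is stated on concrete
   lists so that the 512 candidates can be filtered by computation. *)
Definition exact_cover2 (p : corner -> bool) (s : bitseq) : bool :=
  all (fun v : vertex2 =>
    sumn [seq nat_of_bool (nth false s i &&
                ((v == (edge2 i).1.1) || (v == (edge2 i).1.2))) | i <- iota 0 9]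
    == if v is inl k then nat_of_bool (p k) else 1%N)
  [:: inl CL; inl CU; inl CR;
      inr (@Ordinal 3 0 isT); inr (@Ordinal 3 1 isT); inr (@Ordinal 3 2 isT)].

Lemma exact_cover2E p s :
  exact_cover (G := Gamma2) p [set i : 'I_9 | nth false s i] = exact_cover2 p s.
Proof.
set M := [set i | _].
have deg v : degree (G := Gamma2) M v =
    sumn [seq nat_of_bool (nth false s i &&
      ((v == (edge2 i).1.1) || (v == (edge2 i).1.2))) | i <- iota 0 9].
  rewrite degreeE big_mkcond sumnE big_map -[iota 0 9]/(index_iota 0 9) big_mkord.
  apply: eq_bigr => i _; rewrite inE /incident /= (tnth_nth (inl CL, inl CL, La)).
  by case: nth.
have cornersE v : (v \in corners Gamma2) = if v is inl _ then true else false.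
  apply/imsetP; case: v => [k|i]; first by exists k.
  by case.
rewrite /exact_cover forall_corner /exact_cover2 !deg andbC -!andbA.
rewrite [RHS]/all; congr [&& _, _, _ & _]; rewrite andbT.
apply/forall_inP/and3P => [nc|[e0 e1 e2] [k|[[|[|[|i]]] ilt]]]; rewrite ?cornersE // ?deg.
- by split; rewrite -deg; apply: nc; rewrite cornersE.
- by rewrite (_ : Ordinal ilt = @Ordinal 3 0 isT) //; apply: val_inj.
- by rewrite (_ : Ordinal ilt = @Ordinal 3 1 isT) //; apply: val_inj.
- by rewrite (_ : Ordinal ilt = @Ordinal 3 2 isT) //; apply: val_inj.
Qed.

Lemma set_weight2 s :
  set_weight (G := Gamma2) (weight a b c) [set i : 'I_9 | nth false s i] =
  \prod_(0 <= i < 9) if nth false s i then weight a b c (edge2 i).2 else 1.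
Proof.
rewrite /set_weight big_mkcond big_mkord; apply: eq_bigr => i _.
by rewrite inE /= (tnth_nth (inl CL, inl CL, La)).
Qed.

Lemma cover_sum_Gamma2 l u r :
  cover_sum Gamma2 (weight a b c) (pattern l u r) =
  if odd (l + u + r) then
    if (1 < l + u + r)%N then a ^+ 3 + b ^+ 3 else c * (a + b)
  else 0.
Proof.
rewrite /cover_sum big_mkcond big_set_bitseqs.
under eq_bigr => s _ do rewrite exact_cover2E set_weight2.
rewrite -big_mkcond -big_filter.
(* For each set of corners, the filter leaves two bit sequences if its size is odd and none
   otherwise. *)
case: l u r => [] [] []; set ss := [seq _ <- _ | _]; vm_compute in ss;
  rewrite /ss ?big_cons ?big_nat_recl ?big_geq //= !big_nil; ring.
Qed.

End Base.

(** * Solving the recursion over the levels *)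

Lemma corner_of_Gamma_inj m : injective (corner_of (iter m glue Gamma2)).
Proof. by elim: m => [x y []|m /corner_of_glue_inj]. Qed.

Lemma big_bool3 (T : Type) (idx : T) (op : Monoid.com_law idx)
    (F : bool * bool * bool -> T) :
  \big[op/idx]_t F t =
  op (op (op (F (true, true, true)) (F (true, true, false)))
         (op (F (true, false, true)) (F (true, false, false))))
     (op (op (F (false, true, true)) (F (false, true, false)))
         (op (F (false, false, true)) (F (false, false, false)))).
Proof.
transitivity (\big[op/idx]_(x : bool) \big[op/idx]_(y : bool)
  \big[op/idx]_(z : bool) F (x, y, z)); last by rewrite !big_bool.
by rewrite !pair_bigA; apply: eq_bigr => -[[]].
Qed.

Section Level.
Variables (R : comNzRingType) (P Q : R).

(* This is C_(m+2). *)
Fixpoint level_factor (m : nat) : R :=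
  if m is m'.+1 then 2 * level_factor m' ^+ 3 * (if odd m' then P else Q) ^+ 2
  else 1.

Lemma expn3_mod4 m : (3 ^ m %% 4 = if odd m then 3 else 1)%N.
Proof.
elim: m => // m IHm; rewrite expnS -modnMmr IHm /=.
by case: (odd m).
Qed.

(** Cubing triples all exponents; each step then adds 1 to the exponent of 2, and 2 to that of P or
    of Q according to the parity of the level. *)
Lemma level_factorE m :
  level_factor m =
  2 ^+ ((3 ^ m - 1) %/ 2)
  * P ^+ ((3 ^ m - (if odd m then 3 else 1)%N) %/ 4)
  * Q ^+ ((3 ^ m.+1 - (if odd m then 1 else 3)%N) %/ 4).
Proof.
elim: m => [|m IHm]; first by rewrite /= !expr0 !mulr1.
rewrite /= IHm.
(* The residue of t modulo 4 ensures that the divisions are exact and that no subtraction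
   truncates. *)
have := expn3_mod4 m; rewrite !expnS; set t := (3 ^ m)%N.
case: (odd m) => /= tE.
- have -> : ((3 * t - 1) %/ 2 = (t - 1) %/ 2 * 3 + 1)%N by lia.
  have -> : ((3 * (3 * t) - 3) %/ 4 = (3 * t - 1) %/ 4 * 3)%N by lia.
  have -> : ((3 * t - 1) %/ 4 = (t - 3) %/ 4 * 3 + 2)%N by lia.
  by rewrite !(exprD, exprM); ring.
- have -> : ((3 * t - 1) %/ 2 = (t - 1) %/ 2 * 3 + 1)%N by lia.
  have -> : ((3 * (3 * t) - 1) %/ 4 = (3 * t - 3) %/ 4 * 3 + 2)%N by lia.
  have -> : ((3 * t - 3) %/ 4 = (t - 1) %/ 4 * 3)%N by lia.
  by rewrite !(exprD, exprM); ring.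
Qed.

End Level.

(** Each junction is covered by one copy, so the copies cover |S| + 3 corners in all, which makes
    the parity alternate. The choices at the junctions orient a triangle with prescribed in-degree
    parities: there are two such orientations, reverse to each other, whence the factor 2. The total
    |S| + 3 then fixes how many copies contribute P and how many Q. *)
Lemma cover_sum_Gamma (R : comNzRingType) (a b c : R) m l u r :
  cover_sum (iter m glue Gamma2) (weight a b c) (pattern l u r) =
  if odd (l + u + r) == odd m then 0
  else level_factor (a ^+ 3 + b ^+ 3) (c * (a + b)) m
       * (if (1 < l + u + r)%N then a ^+ 3 + b ^+ 3 else c * (a + b)).
Proof.
elim: m l u r => [|m IHm] l u r.
  by rewrite cover_sum_Gamma2 mul1r /=; case: odd.
rewrite iterS cover_sum_glue; last exact: corner_of_Gamma_inj.
rewrite big_bool3 !big_corner /copy_pattern /= !IHm.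
set P := a ^+ 3 + b ^+ 3; set Q := c * (a + b).
(* With P, Q and C as atoms, each case is a polynomial identity between them. *)
move: P Q => P Q; move: (level_factor P Q m) => C.
by case: l u r (odd m) => [] [] [] [] /=; ring.
Qed.

(* All the divisions of exponents below are exact. *)
Theorem theorem4p3 (R : realFieldType) (n : nat) (a b c : R)
  (hn : (2 <= n)%N) (ha : 0 < a) (hb : 0 < b) (hc : 0 < c) :
  (~~ odd n ->
     Phi n a b c =
       2 ^+ ((3 ^ (n - 2) - 1) %/ 2)
       * (a ^+ 3 + b ^+ 3) ^+ ((3 ^ (n - 2) - 1) %/ 4)
       * (a * c + b * c) ^+ ((3 ^ (n - 1) - 3) %/ 4)
       * (a ^+ 3 + b ^+ 3 + 3 * c * (a + b)))
  /\
  (odd n ->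
     Phi n a b c =
       2 ^+ ((3 ^ (n - 2) - 1) %/ 2)
       * (a ^+ 3 + b ^+ 3) ^+ ((3 ^ (n - 2) - 3) %/ 4)
       * (a * c + b * c) ^+ ((3 ^ (n - 1) - 1) %/ 4)
       * (3 * (a ^+ 3 + b ^+ 3) + c * (a + b))).
Proof.
have -> : a * c + b * c = c * (a + b) by ring.
have := dimer_sumE (weight a b c) (odd n) (@corner_of_Gamma_inj (n - 2)).
rewrite -[LHS]/(Phi n a b c) => ->.
have n1 : (n - 1 = (n - 2).+1)%N by lia.
have on : odd n = odd (n - 2) by rewrite oddB // addbF.
(* For n even, the three singletons give Q each and the full set of corners gives P; for n odd, the
   empty set gives Q and the three pairs give P each. *)
rewrite big_mkcond big_bool3 /= !cover_sum_Gamma level_factorE n1 on.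
by split=> [/negPf|] ->; rewrite /= ?inE /=; ring.
Qed.
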